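(* Let $\mathcal{F}$ be a saturated fusion system on the finite $p$-group $S$ ($p$ a prime), and suppose that $\mathcal{C}$ is a conjugation family for $\mathcal{F}$. Let $P, P' \leq S$ and let $\varphi\colon P \to P'$ be an isomorphism in $\mathcal{F}$. Then there exists a $\mathcal{C}$-decomposition $(Q_i, \alpha_i)_{1 \leq i \leq n}$ of $\varphi$ together with an integer $0 \leq k \leq n$ such that, setting $P_0 = P$ and $P_i = P^{\alpha_1\cdots\alpha_i}$ for $1\leq i\leq n$ (so $P_n = P'$), \[ |C_S(P)| \leq |C_S(P_1)| \leq \cdots \leq |C_S(P_k)| \geq \cdots \geq |C_S(P_{n-1})| \geq |C_S(P')|. \]
   Context: Saturated fusion systems on finite $p$-groups are taken in the standard sense. Maps are composed left-to-right, and $P^{\alpha}$ denotes the image of $P$ under $\alpha$. A conjugation family $\mathcal{C}$ for $\mathcal{F}$ is a set of subgroups of $S$ such that every morphism (every isomorphism between subgroups of $S$) in $\mathcal{F}$ is a composition of restrictions of elements of $\operatorname{Aut}_{\mathcal{F}}(Q)$ as $Q$ ranges over $\mathcal{C}$. Given an isomorphism $\varphi\colon P\to P'$ in $\mathcal{F}$ between subgroups of $S$, a $\mathcal{C}$-decomposition of $\varphi$ is a finite sequence $(Q_i,\alpha_i)_{1\le i\le n}$ with $Q_i\in\mathcal{C}$ and $\alpha_i\in\operatorname{Aut}_{\mathcal{F}}(Q_i)$ such that $\varphi=\alpha_1\cdots\alpha_n$ after restriction of the $\alpha_i$; that is, with $P_0=P$ and $P_i=P_{i-1}^{\alpha_i}$,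 one has $P_{i-1}\le Q_i$ for each $1\le i\le n$, and $\varphi$ is the composite (applied left to right) of the restrictions $\alpha_i|_{P_{i-1}}\colon P_{i-1}\to P_i$. *)

(* Defs.v *)
From HB Require Import structures.
From mathcomp Require Import all_boot all_fingroup all_solvable.

Set Implicit Arguments.
Unset Strict Implicit.
Unset Printing Implicit Defensive.

Local Open Scope group_scope.

(* A map P -> Q is represented by a function on the ambient type gT, of which *)
(* only the values on P matter (fhom_ext).  The hom-sets between groups that  *)
(* are not both subgroups of S, i.e. not objects of the category, are empty.  *)
Record fusion_system (gT : finGroupType) (S : {group gT}) := FusionSystem {
  fhom : {group gT} -> {group gT} -> pred (gT -> gT);
  fhom_obj : forall (P Q : {group gT}) (f : gT -> gT),
    fhom P Q f -> P \subset S /\ Q \subset S;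
  fhom_ext : forall (P Q : {group gT}) (f g : gT -> gT),
    {in P, f =1 g} -> fhom P Q f -> fhom P Q g;
  fhom_inj : forall (P Q : {group gT}) (f : gT -> gT),
    fhom P Q f ->
    [/\ {in P &, {morph f : x y / x * y}}, {in P &, injective f}
      & f @: P \subset Q];
  fhom_conj : forall (P Q : {group gT}) (s : gT),
    P \subset S -> Q \subset S -> s \in S -> P :^ s \subset Q ->
    fhom P Q (fun x => x ^ s);
  fhom_comp : forall (P Q R : {group gT}) (f g : gT -> gT),
    fhom P Q f -> fhom Q R g -> fhom P R (g \o f);
  (* f is an isomorphism onto its image R, followed by an inclusion *)
  fhom_img : forall (P Q R : {group gT}) (f : gT -> gT),
    fhom P Q f -> f @: P = R :> {set gT} ->
    fhom P R f /\ (forall g : gT -> gT, {in P, cancel f g} -> fhom R P g)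
}.

Section FusionSystems.

Variables (gT : finGroupType) (S : {group gT}) (F : fusion_system S).
Implicit Types (P Q : {group gT}) (f phi : gT -> gT).

Definition fiso P Q f : bool := fhom F P Q f && (f @: P == Q).

Lemma fisoP P Q f :
  reflect (fhom F P Q f /\
           exists g, [/\ fhom F Q P g, {in P, cancel f g} & {in Q, cancel g f}])
          (fiso P Q f).
Proof.
apply: (iffP andP) => [[Ff /eqP defQ]|[Ff [g [Fg fK gK]]]]; split=> //.
  have [_ f_inj _] := fhom_inj Ff; have [_ Finv] := fhom_img Ff defQ.
  pose g y := odflt 1 [pick x in P | f x == y].
  have fK : {in P, cancel f g}.
    move=> x Px; rewrite /g; case: pickP => [y /andP[Py /eqP/f_inj->] //|].
    by move/(_ x); rewrite Px eqxx.
  exists g; split=> //; first exact: Finv.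
  by move=> y; rewrite -defQ => /imsetP[x Px ->]; rewrite fK.
have [_ _ sfPQ] := fhom_inj Ff; have [_ _ sgQP] := fhom_inj Fg.
rewrite eqEsubset sfPQ; apply/subsetP=> y Qy; rewrite -(gK y Qy).
by apply/imset_f/(subsetP sgQP)/imset_f.
Qed.

Definition fconj P Q : Prop := exists f, fiso P Q f.

(* Automorphisms are permutations of gT fixing the complement of P, as in     *)
(* MathComp's Aut; products of permutations compose left to right.            *)
Definition AutF P : {set {perm gT}} := [set a in Aut P | fhom F P P a].

Lemma group_set_AutF P : P \subset S -> group_set (AutF P).
Proof.
move=> sPS; apply/group_setP; split=> [|a b].
  rewrite inE group1 /=; apply: (@fhom_ext _ _ F P P (fun x => x ^ 1)).
    by move=> x _; rewrite conjg1 perm1.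
  by apply: fhom_conj; rewrite ?group1 // conjsg1.
move=> /setIdP[Aa Fa] /setIdP[Ab Fb]; rewrite inE groupM //=.
by apply: fhom_ext (fhom_comp Fa Fb) => x _; rewrite permM.
Qed.

Definition AutS P : {set {perm gT}} := conj_aut P @* 'N_S(P).

Definition fully_automized (p : nat) P : Prop := p.-Sylow(AutF P) (AutS P).

(* N_phi = { g in N_S(Q) | phi^-1 c_g phi is in Aut_S(P) } for phi : Q -> P:  *)
(* phi^-1 c_g phi sends phi x to phi (x ^ g).                                 *)
Definition Nphi_set Q P phi : {set gT} :=
  [set g in 'N_S(Q) |
    [exists a in AutS P, [forall x in Q, phi (x ^ g) == a (phi x)]]].

Lemma group_set_Nphi Q P phi : group_set (Nphi_set Q P phi).
Proof.
apply/group_setP; split=> [|g h].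
  rewrite inE group1; apply/exists_inP; exists 1; first exact: group1.
  by apply/forall_inP=> x _; rewrite conjg1 perm1.
move=> /setIdP[Ng /exists_inP[a Aa /forall_inP ga]] /setIdP[Nh].
case/exists_inP=> b Ab /forall_inP hb.
rewrite inE groupM //=; apply/exists_inP; exists (a * b); first exact: groupM.
apply/forall_inP=> x Qx; rewrite permM -(eqP (ga x Qx)) conjgM.
by apply: hb; case/setIP: Ng => _ /memJ_norm->.
Qed.

Definition Nphi Q P phi : {group gT} := Group (group_set_Nphi Q P phi).

Definition receptive P : Prop :=
  forall Q phi, fiso Q P phi ->
  exists psi, fhom F (Nphi Q P phi) S psi /\ {in Q, psi =1 phi}.

Definition saturated (p : nat) : Prop :=
  forall P, P \subset S ->
  exists Q, [/\ fconj P Q, fully_automized p Q & receptive Q].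

Definition decomp : Type := seq ({group gT} * {perm gT}).

(* P^(alpha_1 ... alpha_i); the pair (Q_i, alpha_i) is the entry i.-1 of s.   *)
Definition dec_img P (s : decomp) (i : nat) : {set gT} :=
  (\prod_(Qa <- take i s) Qa.2) @: P.

(* The empty sequence decomposes the identity of P. *)
Definition is_decomp (C : {set {group gT}}) P phi (s : decomp) : Prop :=
  [/\ forall Qa, Qa \in s -> Qa.1 \in C /\ Qa.2 \in AutF Qa.1,
      forall i, i < size s -> dec_img P s i \subset (nth (1%G, 1) s i).1
    & {in P, phi =1 \prod_(Qa <- s) Qa.2}].

Definition conjugation_family (C : {set {group gT}}) : Prop :=
  C \subset subgroups S /\
  forall P P' phi, fiso P P' phi -> exists s, is_decomp C P phi s.

End FusionSystems.

(* Main.v *)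
(** Let R be receptive and chi : P -> R an isomorphism.  Then chi extends to a
    subgroup N containing both P and 'C_S(P), and any C-decomposition of the
    extension restricts to a decomposition of chi along which the images of
    'C_S(P) centralize the images of P; so no intermediate centralizer is
    smaller than 'C_S(P).  Cutting at the first image whose centralizer is
    strictly larger and iterating from there gives a decomposition of chi along
    which the centralizer orders are nondecreasing.  For phi : P -> P', choose
    chi : P' -> R with R receptive, and follow such a decomposition of
    P -> P' -> R by the reverse of one of chi. *)

Require Import Defs.
From HB Require Import structures.
From mathcomp Require Import all_boot all_fingroup all_solvable.

Set Implicit Arguments.
Unset Strict Implicit.
Unset Printing Implicit Defensive.

Local Open Scope group_scope.

Section MonotoneDecompositions.

Variables (gT : finGroupType) (S : {group gT}) (F : fusion_system S).
Variable C : {set {group gT}}.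
Implicit Types (P Q R : {group gT}) (A B D : {set gT}) (s t : decomp gT).
Implicit Types (r : rel nat) (f : gT -> gT).

(** * Restricting and composing morphisms of the fusion system *)

Lemma fhom_image_group P Q f :
  fhom F P Q f -> exists R : {group gT}, f @: P = R :> {set gT}.
Proof.
case/fhom_inj=> fM _ _; exists (Morphism fM @* P)%G.
by rewrite /= morphimEdom.
Qed.

Lemma fhom_incl P Q : P \subset Q -> Q \subset S -> fhom F P Q id.
Proof.
move=> sPQ sQS; apply: (@fhom_ext _ _ F P Q (fun x => x ^ 1)).
  by move=> x _; rewrite conjg1.
by apply: fhom_conj; rewrite ?conjsg1 // (subset_trans sPQ).
Qed.

Lemma fiso_comp P Q R (f g : gT -> gT) :
  fiso F P Q f -> fiso F Q R g -> fiso F P R (g \o f).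
Proof.
case/andP=> Ff /eqP defQ /andP[Fg /eqP defR].
by rewrite /fiso (fhom_comp Ff Fg) imset_comp defQ defR eqxx.
Qed.

Lemma fiso_ext P Q (f g : gT -> gT) :
  {in P, f =1 g} -> fiso F P Q f -> fiso F P Q g.
Proof.
move=> efg /andP[Ff /eqP defQ]; rewrite /fiso (fhom_ext efg Ff) -defQ.
by rewrite (eq_in_imset efg) eqxx.
Qed.

(** * Decompositions as walks through images *)

Definition total s : {perm gT} := \prod_(Qa <- s) Qa.2.

Lemma total_cons Qa s : total (Qa :: s) = Qa.2 * total s.
Proof. by rewrite /total big_cons. Qed.

Lemma total_seq1 Qa : total [:: Qa] = Qa.2.
Proof. by rewrite /total big_seq1. Qed.

Lemma total_cat s t : total (s ++ t) = total s * total t.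
Proof. by rewrite /total big_cat. Qed.

Lemma imset_permM (a b : {perm gT}) A : (a * b) @: A = b @: (a @: A).
Proof. by rewrite -imset_comp; apply: eq_imset => x; rewrite permM. Qed.

Lemma imset_perm1 A : (1 : {perm gT}) @: A = A.
Proof. by rewrite -[RHS]imset_id; apply: eq_imset => x; rewrite perm1. Qed.

(** Recursive form of a decomposition, detached from the map it decomposes. The parameter [r]
    constrains consecutive centralizer orders: always true for plain decompositions, [leq] for
    ascents, and a relation ignoring its first argument for a uniform lower bound. *)
Fixpoint walk r A s : bool :=
  if s is Qa :: s' then
    [&& Qa.1 \in C, Qa.2 \in AutF F Qa.1, A \subset Qa.1,
        r #|'C_S(A)| #|'C_S(Qa.2 @: A)| & walk r (Qa.2 @: A) s']
  else true.

Lemma sub_walk r r' A s : subrel r r' -> walk r A s -> walk r' A s.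
Proof.
move=> srr'; elim: s A => //= Qa s IHs A /and5P[-> -> -> /srr'-> /=].
exact: IHs.
Qed.

Lemma walk_cat r A s t :
  walk r A (s ++ t) = walk r A s && walk r (total s @: A) t.
Proof.
elim: s A => [|Qa s IHs] A /=; first by rewrite /total big_nil imset_perm1.
by rewrite IHs total_cons imset_permM -!andbA.
Qed.

(** Invert each automorphism and reverse the order: the same images are met backwards, so an ascent
    becomes a descent. *)
Lemma walk_rev r A s : walk r A s ->
  exists2 t, total t = (total s)^-1 & walk (fun x y => r y x) (total s @: A) t.
Proof.
elim: s A => [|[Q a] s IHs] A /=.
  by exists [::]; rewrite // /total big_nil invg1.
case/and5P=> CQ Fa sAQ rA /IHs[t def_t wt].
exists (t ++ [:: (Q, a^-1)]).
  by rewrite total_cat def_t total_seq1 total_cons invMg.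
have sQS: Q \subset S by case/setIdP: Fa => _ /fhom_obj[].
rewrite total_cons imset_permM walk_cat wt def_t /= CQ.
rewrite -imset_permM mulgV imset_perm1 -imset_permM mulgV imset_perm1 rA !andbT.
(* [AutF F Q] is only a set; its group structure, available as Q lies in S, gives closure under
   inverses. *)
rewrite -[AutF F Q]/(gval (Group (group_set_AutF F sQS))) groupV Fa /=.
case/setIdP: Fa => /setIdP[aQ _] _.
apply/subsetP=> _ /imsetP[x Ax ->].
by rewrite (perm_closed _ aQ) (subsetP sAQ).
Qed.

Lemma walkP r A s :
  walk r A s <->
  (forall Qa, Qa \in s -> Qa.1 \in C /\ Qa.2 \in AutF F Qa.1) /\
  (forall i, i < size s ->
     total (take i s) @: A \subset (nth (1%G, 1) s i).1 /\
     r #|'C_S(total (take i s) @: A)| #|'C_S(total (take i.+1 s) @: A)|).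
Proof.
elim: s A => [|Qa s IHs] A //=; split.
  case/and5P=> CQ Fa sAQ rA /IHs[Cs ws]; split=> [Qb|[|i] lt_i_s].
  - by rewrite inE => /predU1P[-> | /Cs].
  - by rewrite !take0 total_seq1 /total big_nil imset_perm1.
  - by rewrite /= !total_cons !imset_permM; apply: ws.
case=> Cs ws; have [CQ Fa] := Cs Qa (mem_head _ _).
have:= ws 0 isT.
rewrite /= !take0 total_seq1 /total big_nil imset_perm1 => -[sAQ rA].
rewrite CQ Fa sAQ rA; apply/IHs; split=> [Qb sQb|i lt_i_s].
  by apply: Cs; rewrite inE sQb orbT.
by have:= ws i.+1 lt_i_s; rewrite /= !total_cons !imset_permM.
Qed.

Lemma is_decompP P f s :
  is_decomp F C P f s <->
  walk (fun _ _ => true) P s /\ {in P, f =1 total s}.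
Proof.
split=> [[Cs ws fs] | [/walkP[Cs ws] fs]].
  by split=> //; apply/walkP; split=> // i /ws.
by split=> // i /ws[].
Qed.

Lemma walk_fiso r P s : P \subset S -> walk r P s ->
  exists2 R : {group gT}, total s @: P = R & fiso F P R (total s).
Proof.
elim: s P => [|[Q a] s IHs] P sPS /=.
  rewrite /total big_nil imset_perm1 => _; exists P => //.
  apply: (@fiso_ext _ _ id) => [x _|]; first by rewrite perm1.
  by rewrite /fiso fhom_incl // imset_id eqxx.
case/and5P=> _ /setIdP[_ /= Fa] sPQ _ ws.
have [_ sQS] := fhom_obj Fa.
have {}Fa: fhom F P Q a := fhom_comp (fhom_incl sPQ sQS) Fa.
have [P1 defP1] := fhom_image_group Fa.
have [Fa1 _] := fhom_img Fa defP1.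
have [_ sP1S] := fhom_obj Fa1.
rewrite defP1 in ws; have [R defR Fs] := IHs _ sP1S ws.
exists R; first by rewrite total_cons imset_permM defP1.
apply: (@fiso_ext _ _ (total s \o a)) => [x _|].
  by rewrite total_cons permM.
by apply: fiso_comp Fs; rewrite /fiso Fa1 defP1 eqxx.
Qed.

(** * Extending to the centralizer *)

(** Transported along [f], conjugation by g in P becomes conjugation by [f g], and conjugation by g
    in ['C_S(P)] becomes the identity; both lie in [AutS S R]. *)
Lemma sub_Nphi_cent P R f :
  fiso F P R f -> P \subset Nphi S P R f /\ 'C_S(P) \subset Nphi S P R f.
Proof.
case/andP=> Ff /eqP defR; have [sPS sRS] := fhom_obj Ff.
have [fM _ sfPR] := fhom_inj Ff.
split; apply/subsetP=> g.
  move=> Pg; have Rfg: f g \in R by rewrite -defR imset_f.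
  have NRfg: f g \in 'N_S(R) by rewrite inE (subsetP sRS) ?(subsetP (normG R)).
  have NPg: g \in 'N_S(P) by rewrite inE (subsetP sPS) ?(subsetP (normG P)).
  rewrite inE NPg; apply/exists_inP; exists (conj_aut R (f g)).
    by apply: mem_morphim => //; case/setIP: NRfg.
  apply/forall_inP=> x Px.
  have fX y z : y \in P -> z \in P -> f (y * z) = f y * f z.
    by move=> Py Pz; apply: fM.
  rewrite norm_conj_autE ?(subsetP (normG R)) //; last by rewrite -defR imset_f.
  (* Multiplying by [f g] on the left turns the conjugates into products in P, where [f] is
     multiplicative. *)
  by rewrite -(inj_eq (mulgI (f g))) -conjgC -!fX ?groupJ // -conjgC.
case/setIP=> Sg CPg; rewrite inE.
rewrite inE Sg (subsetP (cent_sub P)) //=; apply/exists_inP; exists 1.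
  exact: group1.
apply/forall_inP=> x Px; rewrite perm1 /conjg -(centP CPg x Px).
by rewrite mulKg.
Qed.

(* Taking B := 'C_S(A), the images of B stay in the centralizers of the
   images of A as long as the decomposition is defined on B as well. *)
Lemma walk_card_cent r D A B s :
    walk r D s -> A \subset D -> B \subset D -> B \subset 'C(A) ->
  walk (fun _ m => #|B| <= m) A s.
Proof.
elim: s D A B => //= -[Q a] s IHs D A B /and5P[-> Fa sDQ _ ws] sAD sBD cAB /=.
have /setIdP[/setIdP[aQ /morphicP aM] /fhom_obj[_ sQS]] := Fa.
rewrite Fa (subset_trans sAD sDQ) /=.
have saD (X : {set gT}) : X \subset D -> a @: X \subset a @: D by exact: imsetS.
have caB: a @: B \subset 'C(a @: A).
  apply/centsP=> _ /imsetP[y By ->] _ /imsetP[x Ax ->].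
  have Qx: x \in Q by rewrite (subsetP sDQ) ?(subsetP sAD).
  have Qy: y \in Q by rewrite (subsetP sDQ) ?(subsetP sBD).
  by rewrite /commute -!aM // (centsP cAB y By x Ax).
have <-: #|a @: B| = #|B| by rewrite card_imset //; apply: perm_inj.
rewrite (IHs (a @: D)) ?saD // andbT subset_leq_card // subsetI caB andbT.
apply/subsetP=> _ /imsetP[y By ->]; apply: (subsetP sQS).
by rewrite perm_closed // (subsetP sDQ) ?(subsetP sBD).
Qed.

Lemma receptive_walk P R f :
    conjugation_family F C -> receptive F R -> fiso F P R f ->
  exists2 s, walk (fun _ m => #|'C_S(P)| <= m) P s & {in P, f =1 total s}.
Proof.
move=> [_ Cdec] recR Ff; have [sPN sCN] := sub_Nphi_cent Ff.
have [psi [Fpsi eq_psi]] := recR _ _ Ff.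
(* A conjugation family decomposes isomorphisms, so the target S of [psi] is cut down to its
   image. *)
have [N1 defN1] := fhom_image_group Fpsi.
have [Fpsi1 _] := fhom_img Fpsi defN1.
have [|s /is_decompP[ws psi_s]] := Cdec (Nphi S P R f) N1 psi.
  by rewrite /fiso Fpsi1 defN1 eqxx.
exists s; first exact: walk_card_cent ws sPN sCN (subsetIr _ _).
by move=> x Px; rewrite -eq_psi // psi_s // (subsetP sPN).
Qed.

(** * Monotone decompositions *)

(** As long as the order stays equal to m the walk is nondecreasing; the first step that leaves m
    goes up, and the cut is made right after it. *)
Lemma walk_climb m A s :
    #|'C_S(A)| = m -> walk (fun _ k => m <= k) A s ->
  walk leq A s \/
  exists s1 s2, [/\ s = s1 ++ s2, walk leq A s1 & m < #|'C_S(total s1 @: A)|].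
Proof.
elim: s A => [|Qa s IHs] A defm /=; first by left.
case/and5P=> CQ Fa sAQ le_m ws.
have:= le_m; rewrite leq_eqVlt => /predU1P[eq_m | lt_m].
  have [wl | [s1 [s2 [-> wl lt_m]]]] := IHs _ (esym eq_m) ws.
    by left; rewrite CQ Fa sAQ defm le_m.
  right; exists (Qa :: s1), s2.
  by rewrite /= CQ Fa sAQ defm le_m total_cons imset_permM.
by right; exists [:: Qa], s; rewrite /= CQ Fa sAQ defm le_m total_seq1.
Qed.

Lemma receptive_monotone_walk P R f :
    conjugation_family F C -> receptive F R -> fiso F P R f ->
  exists2 s, walk leq P s & {in P, f =1 total s}.
Proof.
move=> Cfam recR.
(* The source P varies while R stays fixed, so receptivity remains available. *)
have [n] := ubnP (#|S| - #|'C_S(P)|); elim: n P f => // n IHn P f le_n Ff.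
have [s ws fs] := receptive_walk Cfam recR Ff.
have [wl | [s1 [s2 [def_s wl lt_c]]]] := walk_climb erefl ws; first by exists s.
have sPS: P \subset S by case/andP: Ff => /fhom_obj[].
have [P1 defP1 Fs1] := walk_fiso sPS wl.
have sP1S: P1 \subset S by case/andP: Fs1 => /fhom_obj[].
move: ws; rewrite def_s walk_cat defP1 => /andP[_ ws2].
have [R1 defR1 Fs2] := walk_fiso sP1S ws2.
(* The tail [s2] still ends at R; the induction hypothesis replaces it by an ascent [t] inducing the
   same map on P1. *)
have eqR1: R1 = R.
  apply: val_inj; rewrite /= -defR1 -defP1 -imset_permM -total_cat -def_s.
  by case/andP: Ff => _ /eqP <-; apply: eq_in_imset => x Px; rewrite fs.
rewrite eqR1 in Fs2; rewrite defP1 in lt_c.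
have [|t wt t_s2] := IHn _ _ _ Fs2.
  rewrite ltnS in le_n; apply: leq_trans le_n; apply: ltn_sub2l => //.
  by apply: leq_trans lt_c _; rewrite subset_leq_card // subsetIl.
exists (s1 ++ t); first by rewrite walk_cat wl defP1.
move=> x Px; rewrite fs // def_s !total_cat !permM t_s2 // -defP1.
exact: imset_f.
Qed.

End MonotoneDecompositions.

Theorem proposition3p1 (p : nat) (gT : finGroupType) (S : {group gT})
    (F : fusion_system S) (C : {set {group gT}}) (P P' : {group gT})
    (phi : gT -> gT) :
  prime p -> p.-group S -> saturated F p -> conjugation_family F C ->
  fiso F P P' phi ->
  exists (s : decomp gT) (k : nat),
    [/\ is_decomp F C P phi s,
        k <= size s,
        forall i : nat, i < k ->
          #|'C_S(dec_img P s i)| <= #|'C_S(dec_img P s i.+1)|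
      & forall i : nat, k <= i -> i < size s ->
          #|'C_S(dec_img P s i.+1)| <= #|'C_S(dec_img P s i)| ].
Proof.
move=> _ _ satF Cfam Fphi; have /andP[/fhom_obj[_ sP'S] /eqP defP'] := Fphi.
have [R [[chi Fchi] _ recR]] := satF P' sP'S.
have [s1 w1 e1] := receptive_monotone_walk Cfam recR (fiso_comp Fphi Fchi).
have [s2 w2 e2] := receptive_monotone_walk Cfam recR Fchi.
have [t def_t wt] := walk_rev w2.
have phiP x : x \in P -> phi x \in P' by rewrite -defP'; apply: imset_f.
have e12 x : x \in P -> total s1 x = total s2 (phi x).
  by move=> Px; rewrite -e1 //= e2 ?phiP.
have eqR: total s1 @: P = total s2 @: P'.
  by rewrite -defP' -imset_comp; apply: eq_in_imset => x /e12.
(* The reversed walk [t] starts where [s1] ends. *)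
rewrite -eqR in wt.
have dec_cat i : dec_img P (s1 ++ t) (size s1 + i) =
                 total (take i t) @: (total s1 @: P).
  rewrite /dec_img -/(total _) take_cat ltnNge leq_addr /= addKn.
  by rewrite total_cat imset_permM.
(* The peak, at index [size s1], is the image R. *)
exists (s1 ++ t), (size s1); split.
- apply/is_decompP; split.
    by rewrite walk_cat (sub_walk _ w1) ?(sub_walk _ wt).
  by move=> x Px; rewrite total_cat def_t permM e12 // permK.
- by rewrite size_cat leq_addr.
- move=> i lt_i; have /walkP[_ /(_ i lt_i)[_]] := w1.
  by rewrite /dec_img !takel_cat // ltnW.
move=> i le_i; rewrite -(subnKC le_i) -addnS !dec_cat size_cat leq_add2l.
by move=> lt_i; have /walkP[_ /(_ _ lt_i)[_]] := wt.
Qed.
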